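(* Let $w\in W$ be an alcove in the $s_0$-region. Then the shadow $\mathrm{Sh}(w)$ with respect to the trivial orientation is symmetric about the hyperplane containing the $s_0$-panel of the identity alcove; that is, the reflection in that hyperplane (left multiplication by $s_0$) maps $\mathrm{Sh}(w)$ onto itself.
   Context: $W=\langle s_0,s_1,s_2\mid s_i^2=1,(s_0s_1)^3=(s_0s_2)^3=(s_1s_2)^3=1\rangle$ is the Coxeter group of type $\tilde A_2$, whose elements correspond bijectively to the alcoves of its Coxeter complex (a tiling of the plane by equilateral triangles), on which $W$ acts by left multiplication; the alcoves $x$ and $xs_i$ share a panel of type $i$ (an $s_i$-panel). The reflection in the wall containing the $s_0$-panel of the identity alcove acts on alcoves as $x\mapsto s_0x$. Subscripts of generators are read modulo 3. For $k\ge 0$, $\gamma_i(k)=s_is_{i+1}s_{i+2}\cdots$ ($k$ letters, subscripts increasing by one mod 3) and $\delta_i(k)=s_is_{i-1}s_{i-2}\cdots$ ($k$ letters, subscripts decreasing by one mod 3). Coordinates: for $(n,m)\in\mathbb Z^2$ let $a(n,m)=b(n)\,c(n,m)\in W$, where $b(n)=\gamma_0(n)$ if $n\ge 0$, $b(n)=\delta_2(-n)$ if $n<0$, and $c(n,m)=\delta_{n+1}(m)$ if $m\ge 0$, $c(n,m)=\gamma_{n+2}(-m)$ if $m<0$. Each element of $W$ has exactly one pair of even coordinates, i.e. $(n,m)$ with $n$ even and $a(n,m)=w$. The $s_0$-region is the set of elements whose even coordinates satisfy $n>0$ and $m\ge -n$. Shadow: for $w\in W$ with reduced word $s_{i_1}\cdots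 s_{i_r}$, $\mathrm{Sh}(w)$ is the set of end alcoves $c_r$ of all (possibly folded) galleries $c_0=1,c_1,\dots,c_r$ with $c_t\in\{c_{t-1},c_{t-1}s_{i_t}\}$ for each $t$. It does not depend on the reduced word and equals the Bruhat interval $[1,w]$. *)

(* Defs.v *)
From HB Require Import structures.
From mathcomp Require Import all_boot all_order all_algebra.
From mathcomp Require Import boolp classical_sets.

Set Implicit Arguments.
Unset Strict Implicit.
Unset Printing Implicit Defensive.

Local Open Scope group_scope.

(* The Coxeter group of type A~_2, by generators and relations: words in the
   letters 0, 1, 2 modulo the congruence generated by the Coxeter relations.
   As the generators are involutions, the presented monoid is already the
   presented group, and inversion is word reversal. *)

(* ['Z_3] rather than ['I_3], for arithmetic modulo 3 on subscripts. *)
Definition word := seq 'Z_3.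

Inductive relator : word -> Prop :=
| relator_inv (i : 'Z_3) : relator [:: i; i]
| relator_braid (i j : 'Z_3) : (i < j)%N -> relator [:: i; j; i; j; i; j].

Inductive cox_eq : word -> word -> Prop :=
| cox_rel (u r v : word) : relator r -> cox_eq (u ++ r ++ v) (u ++ v)
| cox_refl (u : word) : cox_eq u u
| cox_sym (u v : word) : cox_eq u v -> cox_eq v u
| cox_trans (u v t : word) : cox_eq u v -> cox_eq v t -> cox_eq u t.

Definition cox_eqb (u v : word) : bool := `[< cox_eq u v >].

Lemma cox_eqb_equiv : equiv_class_of cox_eqb.
Proof.
split=> [u|u v|v u t].
- exact/asboolP/cox_refl.
- by apply/asboolP/asboolP; apply: cox_sym.
- by move=> /asboolP uv /asboolP vt; apply/asboolP/(cox_trans uv).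
Qed.

Canonical cox_eqb_equivRel := EquivRelPack cox_eqb_equiv.

Definition W : Type := {eq_quot cox_eqb}%qT.
HB.instance Definition _ := Choice.on W.
HB.instance Definition _ := EqQuotient.on W.

Definition cls (u : word) : W := (\pi_W u)%qT.

Lemma clsK : cancel (@repr _ W) cls.
Proof. exact: reprK. Qed.

Lemma cls_eqP (u v : word) : cls u = cls v <-> cox_eq u v.
Proof.
split=> [/eqP|uv]; last apply/eqP.
  by rewrite /cls eqmodE => /asboolP.
by rewrite /cls eqmodE; apply/asboolP.
Qed.

Lemma cox_catl (t u v : word) : cox_eq u v -> cox_eq (t ++ u) (t ++ v).
Proof.
elim=> [a r b hr|a|a b _|a b c _ ab _ bc].
- by rewrite !catA -[(_ ++ r) ++ b]catA; apply: cox_rel.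
- exact: cox_refl.
- exact: cox_sym.
- exact: cox_trans ab bc.
Qed.

Lemma cox_catr (t u v : word) : cox_eq u v -> cox_eq (u ++ t) (v ++ t).
Proof.
elim=> [a r b hr|a|a b _|a b c _ ab _ bc].
- by rewrite -!catA; apply: cox_rel.
- exact: cox_refl.
- exact: cox_sym.
- exact: cox_trans ab bc.
Qed.

Lemma cox_cat (u u' v v' : word) :
  cox_eq u u' -> cox_eq v v' -> cox_eq (u ++ v) (u' ++ v').
Proof.
by move=> /(cox_catr v) uu' /(cox_catl u'); apply: cox_trans.
Qed.

Lemma cox_revV (u : word) : cox_eq (rev u ++ u) [::].
Proof.
elim: u => [|i u IHu]; first exact: cox_refl.
rewrite rev_cons cat_rcons; apply: cox_trans IHu.
exact: (cox_rel (rev u) u (relator_inv i)).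
Qed.

Lemma cox_reprK (u : word) : cox_eq (repr (cls u)) u.
Proof. exact/cls_eqP/clsK. Qed.

Definition oneW : W := cls [::].
Definition mulW (x y : W) : W := cls (repr x ++ repr y).
Definition invW (x : W) : W := cls (rev (repr x)).

Lemma mulW_cls (u v : word) : mulW (cls u) (cls v) = cls (u ++ v).
Proof. by apply/cls_eqP/cox_cat; apply: cox_reprK. Qed.

Lemma mulWA : associative mulW.
Proof.
move=> x y z; rewrite -(clsK x) -(clsK y) -(clsK z).
by move: (repr x) (repr y) (repr z) => u v t; rewrite !mulW_cls catA.
Qed.

Lemma mul1W : left_id oneW mulW.
Proof. by move=> x; rewrite -(clsK x) mulW_cls. Qed.

Lemma mulW1 : right_id oneW mulW.
Proof. by move=> x; rewrite -(clsK x) mulW_cls cats0. Qed.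

Lemma mulVW : left_inverse oneW invW mulW.
Proof.
move=> x; rewrite -[X in mulW _ X]clsK mulW_cls.
exact/cls_eqP/cox_revV.
Qed.

Lemma mulWV : right_inverse oneW invW mulW.
Proof.
move=> x; rewrite -[X in mulW X]clsK mulW_cls; apply/cls_eqP.
by have := cox_revV (rev (repr x)); rewrite revK.
Qed.

HB.instance Definition _ := isGroup.Build W mulWA mul1W mulW1 mulVW mulWV.

Definition s (i : 'Z_3) : W := cls [:: i].

Definition value (u : word) : W := \prod_(i <- u) s i.

Definition reduced_word (w : W) (u : word) : Prop :=
  value u = w /\ forall v : word, value v = w -> (size u <= size v)%N.

Definition gamma (i : 'Z_3) (k : nat) : word :=
  [seq (i + j%:R)%R | j <- iota 0 k].

Definition delta (i : 'Z_3) (k : nat) : word :=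
  [seq (i - j%:R)%R | j <- iota 0 k].

(* [Negz k] is the integer -(k+1). *)
Definition bword (n : int) : word :=
  match n with
  | Posz k => gamma 0%R k
  | Negz k => delta 2%:R%R k.+1
  end.

Definition cword (n m : int) : word :=
  match m with
  | Posz k => delta (n + 1)%:~R%R k
  | Negz k => gamma (n + 2)%:~R%R k.+1
  end.

Definition alcove (n m : int) : W := value (bword n) * value (cword n m).

Definition even_coordinates (w : W) (n m : int) : Prop :=
  (2 %| n)%Z /\ alcove n m = w.

Definition s0_region (w : W) : Prop :=
  exists n m : int, even_coordinates w n m /\ (0 < n)%R /\ (- n <= m)%R.

(* [c] lists the alcoves c_0 = 1, c_1, ..., c_r of a gallery of type [u],
   r = size u; at each panel it may cross or fold. *)
Definition folded_gallery (u : word) (c : seq W) : Prop :=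
  [/\ size c = (size u).+1,
      nth 1 c 0 = 1 &
      forall t : nat, (t < size u)%N ->
        nth 1 c t.+1 = nth 1 c t \/
        nth 1 c t.+1 = nth 1 c t * s (nth 0%R u t)].

(* Sh(w) is [shadow u] for any reduced word u of w. *)
Definition shadow (u : word) : set W :=
  [set x | exists2 c : seq W, folded_gallery u c & last 1 c = x]%classic.

(* Main.v *)
Require Import Defs.
From HB Require Import structures.
From mathcomp Require Import all_boot all_order all_algebra.
From mathcomp Require Import boolp classical_sets.
From mathcomp Require Import zify.

(* Let eta(t, u) be the parity of the number of panels of the wall of t crossed
   by the unfolded gallery of type u.  It is invariant under the Coxeter
   relations, which yields the exchange property, and hence that the shadow of
   a reduced word depends only on the element.  So if eta(s_0, u) is odd then
   Sh(u) = Sh(s_0 u') with s_0 u' reduced, and Sh(s_0 u') is the union of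
   Sh(u') and s_0 Sh(u'), which is symmetric.

   That eta(s_0, u) is odd is read off the action of W on Z by affine
   permutations: along the word of a(n, m), n > 0 even, the images p, q of 0, 1
   are exchanged by the first letter s_0, and q < p ever after, so that the wall
   of s_0 is never crossed again. *)

Set Implicit Arguments.
Unset Strict Implicit.
Unset Printing Implicit Defensive.

Import GRing.Theory.
Local Open Scope group_scope.

Lemma value_nil : value [::] = 1.
Proof. by rewrite /value big_nil. Qed.

Lemma value_cons i u : value (i :: u) = s i * value u.
Proof. by rewrite /value big_cons. Qed.

Lemma value_cat u v : value (u ++ v) = value u * value v.
Proof. by rewrite /value big_cat. Qed.

Lemma cls_cat u v : cls (u ++ v) = cls u * cls v.
Proof. by rewrite -mulW_cls. Qed.

Lemma value_cls u : value u = cls u.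
Proof.
elim: u => [|i u IHu]; first exact: value_nil.
by rewrite value_cons IHu -cls_cat.
Qed.

Lemma value_eqP u v : value u = value v <-> cox_eq u v.
Proof. by rewrite !value_cls; apply: cls_eqP. Qed.

Lemma value_relator r : relator r -> value r = 1.
Proof.
move=> hr; rewrite -value_nil; apply/value_eqP.
by have := cox_rel [::] [::] hr; rewrite cats0.
Qed.

Lemma ss i : s i * s i = 1.
Proof. by rewrite -(value_relator (relator_inv i)) !value_cons value_nil mulg1. Qed.

Lemma sV i : (s i)^-1 = s i.
Proof. by apply: (mulgI (s i)); rewrite mulgV ss. Qed.

Lemma ssK i : involutive (fun x => s i * x).
Proof. by move=> x; rewrite mulgA ss mul1g. Qed.

Lemma braid i j : i != j -> s i * s j * s i = s j * s i * s j.
Proof.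
wlog lt_ij : i j / (i < j)%N => [hw|_].
  have [/hw//|/hw hji neq_ij|/val_inj ->] := ltngtP i j; last by rewrite eqxx.
  by rewrite hji // eq_sym.
have := value_relator (relator_braid lt_ij).
rewrite !value_cons value_nil mulg1 !mulgA => hr.
apply: (mulIg (s j * s i * s j)); rewrite !mulgA hr.
by rewrite -(mulgA _ (s j) (s j)) ss mulg1 -(mulgA _ (s i) (s i)) ss mulg1 ss.
Qed.

(* [s i] acts on the integers, on the right, by exchanging p and p + 1 for all
   p = i mod 3. *)
Definition step (i : 'Z_3) (p : int) : int :=
  if p%:~R%R == i then (p + 1)%R else if p%:~R%R == (i + 1)%R then (p - 1)%R else p.

Lemma step_up i p : p%:~R%R = i -> step i p = (p + 1)%R.
Proof. by rewrite /step => ->; rewrite eqxx. Qed.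

Lemma Z3_cases (i j : 'Z_3) : [\/ i = j, i = (j + 1)%R | i = (j + 2%:R)%R].
Proof.
have /or3P [/eqP|/eqP|/eqP] : [|| i == j, i == (j + 1)%R | i == (j + 2%:R)%R].
  by case: i j => [[|[|[|//]]] hi] [[|[|[|//]]] hj].
- exact: Or31.
- exact: Or32.
- exact: Or33.
Qed.

Lemma Z3_add12 (i : 'Z_3) : (i + 1 + 2%:R = i)%R.
Proof. by rewrite -addrA (_ : 1 + 2%:R = 0)%R ?addr0 //; apply/val_inj. Qed.

Lemma Z3_addn1 (i : 'Z_3) : (i + 1 == i)%R = false.
Proof. by case: i => [[|[|[|//]]] hi]. Qed.

Lemma Z3_addn2 (i : 'Z_3) : (i + 2%:R == i)%R = false.
Proof. by case: i => [[|[|[|//]]] hi]. Qed.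

Lemma Z3_addn21 (i : 'Z_3) : (i + 2%:R == i + 1)%R = false.
Proof. by case: i => [[|[|[|//]]] hi]. Qed.

Lemma step_down i p : p%:~R%R = (i + 1)%R -> step i p = (p - 1)%R.
Proof. by rewrite /step => ->; rewrite Z3_addn1 eqxx. Qed.

Lemma step_stay i p : p%:~R%R = (i + 2%:R)%R -> step i p = p.
Proof. by rewrite /step => ->; rewrite Z3_addn2 Z3_addn21. Qed.

Definition act (u : word) (p : int) : int := foldl (fun p i => step i p) p u.

Lemma act_cat u v p : act (u ++ v) p = act v (act u p).
Proof. exact: foldl_cat. Qed.

Lemma stepK i : involutive (step i).
Proof.
move=> p; have [hp|hp|hp] := Z3_cases p%:~R%R i.
- by rewrite (step_up hp) step_down ?addrK // intrD hp.
- by rewrite (step_down hp) step_up ?subrK // intrD hp addrK.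
- by rewrite !(step_stay hp).
Qed.

Lemma step_braid i p :
  step i (step (i + 1)%R (step i p)) =
  step (i + 1)%R (step i (step (i + 1)%R p)).
Proof.
have [hp|hp|hp] := Z3_cases p%:~R%R i.
- have hp1 : ((p + 1)%:~R)%R = (i + 1)%R :> 'Z_3 by rewrite intrD hp.
  have hp2 : ((p + 1 + 1)%:~R)%R = (i + 2%:R)%R :> 'Z_3 by rewrite intrD hp1 -addrA.
  have hp' : p%:~R%R = (i + 1 + 2%:R)%R :> 'Z_3 by rewrite Z3_add12.
  rewrite (step_up hp) (step_up hp1) (step_stay hp2) (step_stay hp').
  by rewrite (step_up hp) (step_up hp1).
- have hp1 : ((p - 1)%:~R)%R = i :> 'Z_3 by rewrite intrD hp addrK.
  have hp1' : ((p - 1)%:~R)%R = (i + 1 + 2%:R)%R :> 'Z_3 by rewrite Z3_add12.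
  have hp2 : ((p + 1)%:~R)%R = (i + 2%:R)%R :> 'Z_3 by rewrite intrD hp -addrA.
  have hp2' : ((p + 1)%:~R)%R = (i + 1 + 1)%R :> 'Z_3 by rewrite intrD hp.
  rewrite (step_down hp) (step_stay hp1') (step_up hp1) subrK.
  by rewrite (step_up hp) (step_stay hp2) (step_down hp2') addrK.
- have hp' : p%:~R%R = (i + 1 + 1)%R :> 'Z_3 by rewrite hp -addrA.
  have hp1 : ((p - 1)%:~R)%R = (i + 1)%R :> 'Z_3 by rewrite intrD hp' addrK.
  have hp2 : ((p - 1 - 1)%:~R)%R = (i + 1 + 2%:R)%R :> 'Z_3 by rewrite Z3_add12 intrD hp1 addrK.
  by rewrite (step_stay hp) (step_down hp') (step_down hp1) (step_stay hp2).
Qed.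

Lemma act_relator r p : relator r -> act r p = p.
Proof.
case=> [i|i j lt_ij] /=; first exact: stepK.
suff -> : step i (step j (step i p)) = step j (step i (step j p)) by rewrite !stepK.
have [ij|->|->] := Z3_cases j i; [|exact: step_braid|].
  by rewrite ij ltnn in lt_ij.
by have := step_braid (i + 2%:R)%R p; rewrite addrAC Z3_add12.
Qed.

Lemma act_cox_eq u v p : cox_eq u v -> act u p = act v p.
Proof.
move=> huv; elim: huv p => [a r b hr|//|a b _ hab|a b c _ hab _ hbc] p.
- by rewrite !act_cat (act_relator _ hr).
- by rewrite hab.
- by rewrite hab hbc.
Qed.

Lemma act_value u v p : value u = value v -> act u p = act v p.
Proof. by move/value_eqP/act_cox_eq. Qed.

Lemma s_inj : injective s.
Proof.
move=> i j sij; pose p := Posz (val i).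
have pi : p%:~R%R = i :> 'Z_3 by rewrite /p; exact: natr_Zp.
have : act [:: i] p = act [:: j] p.
  by apply: act_value; rewrite !value_cons sij.
rewrite /= (step_up pi).
have [|pj|pj] := Z3_cases p%:~R%R j; first by rewrite pi.
  by rewrite step_down //; lia.
by rewrite step_stay //; lia.
Qed.

Fixpoint eta (t : W) (u : word) : bool :=
  if u is i :: u' then (t == s i) (+) eta (t ^ s i) u' else false.

Lemma eta_head i u : eta (s i) (i :: u) = ~~ eta (s i) u.
Proof. by rewrite /= eqxx conjgE mulKg. Qed.

Lemma eta_cat t u v : eta t (u ++ v) = eta t u (+) eta (t ^ value u) v.
Proof.
elim: u t => [|i u IHu] t /=; first by rewrite value_nil conjg1.
by rewrite IHu addbA value_cons conjgM.
Qed.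

Lemma conjg_eq (t x y : W) : (t ^ x == y) = (t == y ^ x^-1).
Proof. by apply/eqP/eqP => [<-|->]; rewrite -conjgM ?mulgV ?mulVg conjg1. Qed.

Lemma eta_relator t r : relator r -> eta t r = false.
Proof.
case=> [i|i j lt_ij] /=.
  by rewrite conjg_eq sV conjgE sV ss mulg1 addbF addbb.
have neq_ij : i != j by apply: contraTneq lt_ij => ->; rewrite ltnn.
have hi : s i ^ s j = s j ^ s i.
  by rewrite !conjgE !sV !mulgA braid // eq_sym.
have hj : (s j ^ s i) ^ s j = s i by rewrite -hi -conjgM ss conjg1.
have hi' : (s i ^ s j) ^ s i = s j by rewrite hi -conjgM ss conjg1.
have hii k : s k ^ s k = s k by rewrite conjgE mulKg.
rewrite !conjg_eq !sV; move: hj (hii i) hi' (hii j).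
move: (s i) (s j) => x y -> -> -> ->.
by case: (t == x); case: (t == y); case: (t == _).
Qed.

Lemma eta_cox_eq t u v : cox_eq u v -> eta t u = eta t v.
Proof.
move=> huv; elim: huv t => [a r b hr|//|a b _ hab|a b c _ hab _ hbc] t.
- by rewrite !eta_cat (eta_relator _ hr) (value_relator hr) conjg1.
- by rewrite hab.
- by rewrite hab hbc.
Qed.

Lemma eta_value t u v : value u = value v -> eta t u = eta t v.
Proof. by move/value_eqP/eta_cox_eq. Qed.

Lemma exchange t u : eta t u ->
  exists u1 i u2, u = u1 ++ i :: u2 /\ t * value u = value (u1 ++ u2).
Proof.
elim: u t => // i u IHu t /=; have [-> _|_ /= /IHu] := eqVneq t (s i).
  by exists [::], i, u; rewrite value_cons ssK.
move=> [u1 [j [u2 [def_u hu]]]]; exists (i :: u1), j, u2; rewrite def_u; split=> //.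
by rewrite /= !value_cons -def_u -hu conjgE sV !mulgA ss mul1g.
Qed.

Definition reduced (u : word) : Prop :=
  forall v, value v = value u -> (size u <= size v)%N.

Lemma reduced_size u v :
  reduced u -> value v = value u -> size v = size u -> reduced v.
Proof. by move=> ru vu su x xv; rewrite su ru // xv. Qed.

Lemma reduced_behead i u : reduced (i :: u) -> reduced u.
Proof. by move=> ru v vu; apply: (ru (i :: v)); rewrite !value_cons vu. Qed.

Lemma eta_reduced_head i u : reduced (i :: u) -> eta (s i) (i :: u).
Proof.
move=> ru; rewrite eta_head; apply/negP => /exchange [u1 [j [u2 [def_u hu]]]].
have := ru (u1 ++ u2); rewrite value_cons hu => /(_ erefl).
by rewrite def_u /= !size_cat /=; lia.
Qed.

Lemma s_commute i j : s i * s j = s j * s i -> i = j.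
Proof.
move=> hij; apply/eqP; apply: contraTT isT => neq_ij.
have := braid neq_ij; rewrite hij -!mulgA ss => /mulgI h.
by case/eqP: neq_ij; apply/s_inj/(mulIg (s j)); rewrite ss.
Qed.

Lemma two_descents b c u v : b != c -> reduced (b :: u) -> reduced (c :: v) ->
    value (b :: u) = value (c :: v) ->
  exists2 y, (size y).+2 = size u & value (b :: u) = value [:: b, c, b & y].
Proof.
move=> neq_bc ru rv huv; set w := value (b :: u).
have := eta_reduced_head rv; rewrite -(eta_value _ huv).
case/exchange=> -[|b' x1] [i [x2 []]] => [[_ def_u]|[<- def_u]].
  rewrite /= value_cons def_u => hw; case/eqP: neq_bc; apply: s_inj.
  by apply: (mulIg (value x2)); rewrite -[in RHS]hw ssK.
rewrite -/w /= value_cons => hw; set x := x1 ++ x2 in hw.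
have size_u : size u = (size x).+1 by rewrite def_u !size_cat /= addnS.
have {}hw : w = value [:: c, b & x] by rewrite !value_cons -hw ssK.
have := eta_reduced_head ru; rewrite (eta_value _ hw) => /exchange.
rewrite -hw => -[[|c' [|b'' z1]] [j [z2 [] /=]]].
- move=> [_ <-]; rewrite value_cons => /mulgI wx.
  by have := ru x (esym wx); rewrite /= size_u; lia.
- move=> [<- _ <-]; rewrite hw !value_cons => h.
  case/eqP: neq_bc; apply: s_commute; apply: (mulIg (value x)).
  by rewrite -!mulgA -h ssK.
- move=> [<- <- def_x] hb; exists (z1 ++ z2).
    by rewrite size_u def_x !size_cat /= addnS.
  by rewrite -/w value_cons -hb ssK.
Qed.

(* The values of the subwords of [u]. *)
Fixpoint Sh (u : word) : set W :=
  if u is i :: u' then [set x | Sh u' x \/ Sh u' (s i * x)]%classic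
  else [set 1]%classic.

Lemma Sh_braid b c y : b != c -> Sh [:: b, c, b & y] = Sh [:: c, b, c & y].
Proof.
move=> /braid hbc; apply/funext => x; apply/propext => /=.
rewrite !ssK !mulgA hbc; tauto.
Qed.

Lemma Sh_reduced u v : reduced u -> reduced v -> value u = value v -> Sh u = Sh v.
Proof.
have [n] := ubnP (size u); elim: n u v => // n IHn u v.
case: u v => [|b u] [|c v] // size_u ru rv huv.
- by have := rv [::] huv.
- by have := ru [::] (esym huv).
have size_uv : size u = size v.
  apply/eqP; rewrite -eqSS eqn_leq; apply/andP; split.
    exact: (ru (c :: v)).
  exact: (rv (b :: u)).
have IH x y : reduced x -> reduced y -> value x = value y -> size x = size u ->
    Sh x = Sh y.
  by move=> rx ry hxy size_x; apply: IHn => //; rewrite size_x.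
have ru' := reduced_behead ru; have rv' := reduced_behead rv.
have [bc|neq_bc] := eqVneq b c.
  move: huv; rewrite -bc !value_cons => /mulgI huv.
  by rewrite /= (IH u v).
have [y size_y hy] := two_descents neq_bc ru rv huv.
have hu : value u = value [:: c, b & y].
  by move: hy; rewrite !(value_cons b) => /mulgI.
have hv : value v = value [:: b, c & y].
  move: hy; rewrite huv !value_cons !mulgA braid // -!mulgA => /mulgI.
  by rewrite mulgA.
have -> : Sh (b :: u) = Sh [:: b, c, b & y].
  rewrite /= (IH u [:: c, b & y]) //.
  exact: (reduced_size ru').
have -> : Sh (c :: v) = Sh [:: c, b, c & y].
  rewrite /= (IH v [:: b, c & y]) //.
  by apply: (reduced_size rv'); rewrite // -size_uv.
exact: Sh_braid.
Qed.

Lemma Sh_descent i u x : reduced u -> eta (s i) u -> Sh u x -> Sh u (s i * x).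
Proof.
move=> ru /exchange [u1 [j [u2 [def_u hu]]]].
have huv : value (i :: u1 ++ u2) = value u by rewrite value_cons -hu ssK.
rewrite -(Sh_reduced (reduced_size ru huv _) ru huv).
  by rewrite /= ssK; tauto.
by rewrite def_u /= !size_cat /= addnS.
Qed.

Definition gallery_from (c0 : W) (u : word) (c : seq W) : Prop :=
  [/\ size c = (size u).+1, nth 1 c 0 = c0 &
      forall t, (t < size u)%N -> nth 1 c t.+1 = nth 1 c t \/
        nth 1 c t.+1 = nth 1 c t * s (nth 0%R u t)].

Lemma galleryP u c0 x :
  (exists2 c, gallery_from c0 u c & last 1 c = x) <-> Sh u (c0^-1 * x).
Proof.
elim: u c0 => [|i u IHu] c0; split=> /=.
- case=> -[|c1 [|c2 c]] [//= _ -> _] <-; exact: mulVg.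
- move=> h; exists [:: c0] => //=; apply: (mulgI c0^-1).
  by rewrite mulVg h.
- case=> -[|c [|c1 c']] [//= [size_c] -> hc] hx.
  have /IHu : exists2 d, gallery_from c1 u d & last 1 d = x.
    exists (c1 :: c') => //; split=> //= [|t lt_t]; first by rewrite size_c.
    exact: (hc t.+1).
  have [/= ->|/= ->] := hc 0 isT; first by left.
  by rewrite invgM sV -mulgA; right.
- move=> h; pose c1 (fold : bool) := if fold then c0 else c0 * s i.
  have [fold /IHu [c [size_c hc0 hc] hx]] : exists fold, Sh u ((c1 fold)^-1 * x).
    by case: h => h; [exists true | exists false; rewrite /c1 invgM sV -mulgA].
  case: c size_c hc0 hc hx => // d c size_c hc0 hc hx.
  exists [:: c0, d & c] => //; split=> //= [|[|t] lt_t]; first by rewrite -size_c.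
    by rewrite /= in hc0; rewrite /= hc0 /c1; case: fold {hc0}; [left | right].
  exact: hc.
Qed.

Lemma shadowE u : shadow u = Sh u.
Proof.
apply/funext => x; apply/propext.
by rewrite -[in Sh u x](mul1g x) -invg1; apply: galleryP.
Qed.

Fixpoint apart (p q : int) (u : word) : bool :=
  (q < p)%R && if u is i :: u' then apart (step i p) (step i q) u' else true.

(* If [t] exchanges p and q, a crossing of the wall of [t] would exchange them. *)
Lemma eta_apart r p q u : act r p = q -> act r q = p -> apart p q u ->
  eta (value r) u = false.
Proof.
elim: u r p q => // i u IHu r p q rp rq /= /andP[lt_qp hu].
have ->: value r == s i = false.
  apply/eqP => ri.
  have ai x : act r x = step i x.
    by rewrite (@act_value r [:: i]) // value_cons value_nil mulg1.
  by case: u hu {IHu} => [|j u] /=; rewrite -!ai rp rq; lia.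
have -> : value r ^ s i = value (i :: r ++ [:: i]).
  by rewrite conjgE sV value_cons value_cat value_cons value_nil mulg1.
by apply: IHu hu; rewrite /= act_cat stepK ?rp ?rq.
Qed.

Lemma gammaS i k : gamma i k.+1 = i :: gamma (i + 1)%R k.
Proof.
rewrite /gamma /= addr0 -[1%N]/(1 + 0)%N iotaDl -map_comp.
by congr (_ :: _); apply: eq_map => j /=; rewrite natrD addrA.
Qed.

Lemma deltaS i k : delta i k.+1 = i :: delta (i - 1)%R k.
Proof.
rewrite /delta /= subr0 -[1%N]/(1 + 0)%N iotaDl -map_comp.
by congr (_ :: _); apply: eq_map => j /=; rewrite natrD opprD addrA.
Qed.

Lemma Z3_sub1 (i : 'Z_3) : (i - 1 = i + 2%:R)%R.
Proof. by congr (_ + _)%R; apply/val_inj. Qed.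

Lemma Z3_sub1D2 (i : 'Z_3) : (i - 1 + 2%:R = i + 1)%R.
Proof. by rewrite -addrA; congr (_ + _)%R; apply/val_inj. Qed.

Lemma apart_gamma_rise k p q i v : (q < p)%R ->
    p%:~R%R = i -> q%:~R%R = (i + 2%:R)%R ->
    (forall p' q', (q' + 2 <= p')%R -> (p'%:~R)%R = (i + (k.*2.+1)%:R)%R ->
       (q'%:~R)%R = (p'%:~R + 1 : 'Z_3)%R -> apart p' q' v) ->
  apart p q (gamma i k.*2.+1 ++ v).
Proof.
elim: k p q i => [|k IHk] p q i lt_qp hp hq hv.
  rewrite /gamma /= addr0 lt_qp step_up // step_stay // hv ?intrD ?hp ?hq //; first lia.
  by rewrite -addrA.
rewrite doubleS 2!gammaS /= lt_qp (step_up hp) (step_stay hq).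
have hp1 : ((p + 1)%:~R)%R = (i + 1)%R :> 'Z_3 by rewrite intrD hp.
have hq1 : q%:~R%R = (i + 1 + 1)%R :> 'Z_3 by rewrite hq -addrA.
rewrite (step_up hp1) (step_down hq1) (_ : (q < p + 1)%R) /=; last lia.
apply: IHk; first lia.
- by rewrite intrD hp1.
- by rewrite intrD hq1 Z3_sub1.
- move=> p' q' le_qp hp' hq'; apply: hv => //.
  by rewrite hp' doubleS !mulrS !addrA.
Qed.

(* p and q move in turn, and the two conjuncts are the two phases. *)
Lemma apart_delta k p q i :
  ((q + 2 <= p)%R -> p%:~R%R = (i + 2%:R)%R -> q%:~R%R = i ->
    apart p q (delta i k)) /\
  ((q < p)%R -> p%:~R%R = i -> q%:~R%R = (i + 2%:R)%R ->
    apart p q (delta i k)).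
Proof.
elim: k p q i => [|k IHk] p q i; first by split=> h _ _ /=; lia.
rewrite deltaS /=; split=> lt_qp hp hq.
  rewrite (step_up hq) (step_stay hp) (_ : (q < p)%R) /=; last lia.
  apply: (IHk _ _ _).2; first lia; first by rewrite hp Z3_sub1.
  by rewrite intrD hq Z3_sub1D2.
rewrite (step_up hp) (step_stay hq) lt_qp /=.
apply: (IHk _ _ _).1; first lia; last by rewrite hq Z3_sub1.
by rewrite intrD hp Z3_sub1D2.
Qed.

Lemma apart_gamma k p q i :
  ((q + 2 <= p)%R -> p%:~R%R = (i + 1)%R -> q%:~R%R = (i + 2%:R)%R ->
    apart p q (gamma i k)) /\
  ((q < p)%R -> p%:~R%R = (i + 2%:R)%R -> q%:~R%R = (i + 1)%R ->
    apart p q (gamma i k)).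
Proof.
elim: k p q i => [|k IHk] p q i; first by split=> h _ _ /=; lia.
rewrite gammaS /=; split=> lt_qp hp hq.
  rewrite (step_down hp) (step_stay hq) (_ : (q < p)%R) /=; last lia.
  apply: (IHk _ _ _).2; first lia; last by rewrite hq -addrA.
  by rewrite intrD hp addrK Z3_add12.
rewrite (step_down hq) (step_stay hp) lt_qp /=.
apply: (IHk _ _ _).1; first lia; first by rewrite hp -addrA.
by rewrite intrD hq addrK Z3_add12.
Qed.

Lemma eta_s0_alcove (n m : int) u : (2 %| n)%Z -> (0 < n)%R ->
  value u = alcove n m -> eta (s 0%R) u.
Proof.
case: n => // n n_even n_gt0; rewrite /alcove -value_cat => /eta_value ->.
have [k ->] : exists k, n = k.+1.*2.
  by exists n./2.-1; lia.
rewrite doubleS -[bword _]/(gamma 0%R _) gammaS cat_cons eta_head.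
rewrite (_ : s 0%R = value [:: 0%R]); last by rewrite value_cons value_nil mulg1.
rewrite (@eta_apart _ 1%R 0%R) //.
rewrite add0r; apply: apart_gamma_rise => //; first exact/val_inj.
have nE : ((k.+1.*2 : int)%:~R = 1 + (k.*2.+1)%:R :> 'Z_3)%R.
  by rewrite doubleS -[RHS]mulrS.
case: m => m p q le_qp hp hq.
  apply: (apart_delta _ _ _ _).1 => //; last by rewrite intrD nE hq hp.
  by rewrite hp intrD nE Z3_add12.
apply: (apart_gamma m.+1 _ _ _).1 => //.
  by rewrite hp intrD nE addrAC Z3_add12.
by rewrite hq hp intrD nE -[RHS]addrA; congr (_ + _)%R; apply/val_inj.
Qed.

Theorem lemma5p13 (w : W) (u : word) (hu : reduced_word w u)
  (hw : s0_region w) :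
  ((fun x : W => (s 0%R * x)%g) @` shadow u = shadow u)%classic.
Proof.
case: hu hw => <- hu [n [m [[n_even def_u] [n_gt0 _]]]].
have ru : reduced u by move=> v; exact: hu.
have sh x : shadow u x -> shadow u (s 0%R * x).
  by rewrite shadowE; apply/(Sh_descent ru)/(eta_s0_alcove n_even n_gt0 (esym def_u)).
apply/seteqP; split=> [_ [x hx <-]|x hx]; first exact: sh.
by exists (s 0%R * x); [exact: sh | exact: ssK].
Qed.
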